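(* Let $X$ be a standard Borel space and let $\Gamma$ be a Borel graph on $X$. Let $d\ge2$. Suppose that there is a bounded geometry weakly orthogonal decomposition of $X$ (with respect to $\Gamma$) with polygonal bound $P$ and orthogonality constant $Q$ satisfying $d\cdot P\le Q$. Then there is a Borel unlayered toast on $X$ (with respect to $\Gamma$).
   Context: $\rho_\Gamma$ denotes the shortest-path-length metric on the connected components of $\Gamma$ (distance $\infty$ between points of different components, and to the empty set); distances between sets are infima. For a sequence $(X_k)_{k\ge1}$ of Borel subsets of $X$ write $X_k^\infty=\bigcup_{n\ge k}X_n$. The sequence is a weakly orthogonal decomposition of $X$ if (i) for every $k$ every connected component of $\Gamma\restriction(X\setminus X_k^\infty)$ is finite, and $\bigcap_{k\ge1}X_k^\infty=\varnothing$; and (ii) there is a constant $Q$ such that for every $k\ge1$, every connected component $R$ of $\Gamma\restriction(X\setminus X_k^\infty)$ and every $n\ge k$: $\rho_\Gamma(R,X_n^\infty)\le Q\Rightarrow\rho_\Gamma(R,X_n^\infty)=1$. It has bounded geometry if moreover (iii) there is a constant $P$ such that for every $k\ge1$ and every connected component $R$ of $\Gamma\restriction(X\setminus X_k^\infty)$, $|\{n\ge k:\rho_\Gamma(R,X_n)=1\}|\le P$. ''With polygonal bound $P$ and orthogonality constant $Q$'' means that $P$ is the smallest constant for which (iii) holds and $Q$ is a constant for which (ii) holds. Let $E_\Gamma$ be the equivalence relation on $X$ whose classes are the connected components of $\Gamma$. A sequence $\{T_n\}$, where each $T_n\subseteq E_\Gamma$ is an equivalence relation on a subset $\mathrm{dom}(T_n)$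 of $X$, is an (unlayered) toast if: (1) each $T_n$-class is finite; (2) $\bigcup_n\mathrm{dom}(T_n)=X$; (3) for each $T_n$-class $C$ and each $T_m$-class $C'$ with $m>n$, if $C\cap C'\ne\varnothing$ then $C\subseteq C'$; (4) for each $T_n$-class $C$ there are $m>n$ and a $T_m$-class $C'$ with $C\subseteq C'\setminus\partial C'$, where $\partial C'=\{x\in C':\rho_\Gamma(x,X\setminus C')=1\}$. It is Borel if each $\mathrm{dom}(T_n)$ is Borel and each $T_n$ is a Borel equivalence relation on $\mathrm{dom}(T_n)$. *)

(* Defs.v *)
From HB Require Import structures.
From mathcomp Require Import all_boot all_order all_algebra.
From mathcomp Require Import all_classical all_reals all_analysis.

Set Implicit Arguments.
Unset Strict Implicit.
Unset Printing Implicit Defensive.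

Import Order.TTheory GRing.Theory Num.Theory.

Local Open Scope classical_set_scope.
Local Open Scope ring_scope.

(* [completeType] requires a point, so completeness of a metric space is spelled
   out by means of Cauchy filters. *)
Definition polish_metric (R : realType) (Y : metricType R) : Prop :=
  (forall F : set_system Y, ProperFilter F -> cauchy F -> exists y : Y, F --> y)
  /\ (exists2 D : set Y, countable D & dense D).

(* The sigma-algebra of [X] is transported by a bijection from the Borel
   sigma-algebra of a Polish space. *)
Definition standard_borel (R : realType) d (X : measurableType d) : Prop :=
  exists (Y : metricType R) (f : X -> Y),
    [/\ polish_metric Y, bijective f &
        forall A : set X,
          measurable A <->
          exists2 B : set Y, <<s [set U : set Y | open U] >> B & A = f @^-1` B].

Section Graphs.
Context {X : Type}.
Implicit Types (G : set (X * X)) (A B C : set X).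

Definition is_graph G : Prop :=
  (forall x y, G (x, y) -> G (y, x)) /\ (forall x, ~ G (x, x)).

Fixpoint walk G (n : nat) (x y : X) : Prop :=
  if n is m.+1 then exists2 z, G (x, z) & walk G m z y else x = y.

Definition connected_in G (x y : X) : Prop := exists n, walk G n x y.

Definition E_ G : set (X * X) := [set p | connected_in G p.1 p.2].

Definition restrict_graph G A : set (X * X) := G `&` (A `*` A).

(* [component G A C]: [C] is a connected component of the graph [G] restricted
   to the vertex set [A]. *)
Definition component G A C : Prop :=
  exists2 x, A x & C = [set y | connected_in (restrict_graph G A) x y].

(* The infimum of the empty set is [+oo], which is therefore the distance
   between points of different components and to the empty set. *)
Definition rho (R : realType) G (x y : X) : \bar R :=
  ereal_inf [set (n%:R)%:E | n in [set n | walk G n x y]].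

Definition rho_set (R : realType) G A B : \bar R :=
  ereal_inf [set rho R G p.1 p.2 | p in A `*` B].

Definition boundary (R : realType) G C : set X :=
  [set x | C x /\ rho_set R G [set x] (~` C) = 1%E].

End Graphs.

Definition borel_graph d (X : measurableType d) (G : set (X * X)) : Prop :=
  is_graph G /\ measurable G.

Section Decompositions.
Context (R : realType) {d : measure_display} {X : measurableType d}.
Implicit Types (G : set (X * X)) (Xs : nat -> set X).

Definition tail Xs (k : nat) : set X := \bigcup_(n in [set n | (k <= n)%N]) Xs n.

(* Sequences [(X_k)_{k >= 1}] are functions on [nat] whose value at [0] is
   irrelevant. *)
Record weakly_orthogonal_decomposition G Xs (Q : R) : Prop := {
  wod_borel : forall k, (1 <= k)%N -> measurable (Xs k);
  wod_finite : forall k C, (1 <= k)%N ->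
    component G (~` tail Xs k) C -> finite_set C;
  wod_vanish : \bigcap_(k in [set k | (1 <= k)%N]) tail Xs k = set0;
  wod_orthogonal : forall k C n, (1 <= k)%N ->
    component G (~` tail Xs k) C -> (k <= n)%N ->
    (rho_set R G C (tail Xs n) <= Q%:E)%E ->
    rho_set R G C (tail Xs n) = 1%E }.

Definition geometry_bounded_by G Xs (P : nat) : Prop :=
  forall k C, (1 <= k)%N -> component G (~` tail Xs k) C ->
    ([set n | (k <= n)%N /\ rho_set R G C (Xs n) = 1%E] #<= `I_P)%card.

Definition polygonal_bound G Xs (P : nat) : Prop :=
  geometry_bounded_by G Xs P /\
  forall P', geometry_bounded_by G Xs P' -> (P <= P')%N.

End Decompositions.

Section Toasts.
Context (R : realType) {d : measure_display} {X : measurableType d}.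
Implicit Types (G T : set (X * X)) (D C : set X).

Record equivalence_on D T : Prop := {
  eqon_sub : T `<=` D `*` D;
  eqon_refl : forall x, D x -> T (x, x);
  eqon_sym : forall x y, T (x, y) -> T (y, x);
  eqon_trans : forall x y z, T (x, y) -> T (y, z) -> T (x, z) }.

Definition eq_class D T C : Prop :=
  exists2 x, D x & C = [set y | T (x, y)].

(* [D n] is the domain of the equivalence relation [T n]. *)
Record toast G (D : nat -> set X) (T : nat -> set (X * X)) : Prop := {
  toast_equiv : forall n, equivalence_on (D n) (T n);
  toast_sub : forall n, T n `<=` E_ G;
  toast_finite : forall n C, eq_class (D n) (T n) C -> finite_set C;
  toast_cover : \bigcup_n D n = setT;
  toast_laminar : forall n m C C', (n < m)%N ->
    eq_class (D n) (T n) C -> eq_class (D m) (T m) C' ->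
    C `&` C' !=set0 -> C `<=` C';
  toast_interior : forall n C, eq_class (D n) (T n) C ->
    exists m C', [/\ (n < m)%N, eq_class (D m) (T m) C' &
                     C `<=` C' `\` boundary R G C'] }.

Definition borel_toast G (D : nat -> set X) (T : nat -> set (X * X)) : Prop :=
  [/\ toast G D T, forall n, measurable (D n) & forall n, measurable (T n)].

End Toasts.

(* Main.v *)
Require Import Defs.
From mathcomp Require Import all_boot all_order all_algebra.
From mathcomp Require Import all_classical all_reals all_analysis.
From mathcomp Require Import lra.

Import Order.TTheory GRing.Theory Num.Theory.
Local Open Scope classical_set_scope.
Local Open Scope ring_scope.

(** Let [T n] be the connectedness relation of the graph restricted to the
    complement [D n] of the [n]-th tail. The [D n] increase to [X], so the
    classes of the [T n] are finite, nested and exhaust [X]. Bounded geometry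
    makes every class [C] interior to a later one: a neighbour of [C] outside [C]
    lies in some [X_m] with [rho(C, X_m) = 1], so all neighbours of [C] avoid the
    tail beyond the finitely many such [m].

    The substance is that [T n] is Borel: walks are obtained by composing
    relations with finite sections, and a Borel set with finite sections has a
    Borel projection. After coding [X] as a Borel subset of the Cantor space, this
    is Novikov's argument: by separation of countably many analytic sets, the
    complement of a Borel set with closed sections is a countable union of
    products of a Borel set and a cylinder, and compactness expresses the absence
    of points in a section by countable operations. *)

(** * Measurability of sets defined by countable quantifiers *)

Section MeasurableFormulas.
Context d (T : measurableType d).

Lemma measurable_exists (I : countType) (F : I -> set T) :
  (forall i, measurable (F i)) -> measurable [set t | exists i, F i t].
Proof.
move=> mF; have -> : [set t | exists i, F i t] = \bigcup_i F i.
  by apply/seteqP; split=> t [i]; [exists i | move=> _ ?; exists i].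
exact: countable_bigcupT_measurable.
Qed.

Lemma measurable_forall (I : countType) (F : I -> set T) :
  (forall i, measurable (F i)) -> measurable [set t | forall i, F i t].
Proof.
move=> mF.
have -> : [set t | forall i, F i t] = ~` [set t | exists i, (~` F i) t].
  apply/seteqP; split=> t /=; first by move=> Ft [i]; apply; apply: Ft.
  by move=> nF i; apply: contrapT => nFi; apply: nF; exists i.
by apply: measurableC; apply: measurable_exists => i; exact: measurableC.
Qed.

Lemma measurable_prop (P : Prop) : measurable [set _ : T | P].
Proof.
have [p|np] := EM P.
  by rewrite (_ : [set _ | _] = setT) //; apply/seteqP; split.
by rewrite (_ : [set _ | _] = set0) //; apply/seteqP; split.
Qed.

Lemma measurable_impl (A B : set T) : measurable A -> measurable B ->
  measurable [set t | A t -> B t].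
Proof.
move=> mA mB; rewrite (_ : [set _ | _] = ~` A `|` B).
  by apply: measurableU => //; exact: measurableC.
apply/seteqP; split=> t /=; last by case.
by move=> AB; have [/AB|] := EM (A t); [right|left].
Qed.

End MeasurableFormulas.

(** * The Cantor space and its pairing *)

Definition bit_cylinders : set (set (nat -> bool)) :=
  range (fun n => [set z : nat -> bool | z n]).

Notation bits := (g_sigma_algebraType bit_cylinders).

Lemma measurable_bit n : measurable [set z : bits | z n].
Proof. by apply: sub_sigma_algebra; exists n. Qed.

Lemma measurable_bit_eq n b : measurable [set z : bits | z n = b].
Proof.
case: b; first exact: measurable_bit.
rewrite (_ : [set _ | _] = ~` [set z : bits | z n]).
  by apply: measurableC; exact: measurable_bit.
by apply/seteqP; split=> z /= /negP; rewrite ?negbK // => /negbTE.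
Qed.

Lemma measurable_fun_bits d (T : measurableType d) (f : T -> bits) :
  (forall n, measurable [set t | f t n]) -> measurable_fun setT f.
Proof.
move=> mf; apply: (@measurability _ _ T bits setT f bit_cylinders) => //.
move=> _ [_ [n _ <-] <-].
by rewrite setTI; exact: mf.
Qed.

(** Serves all maps that rearrange coordinates: they pull basic cylinders back to basic
    cylinders. *)
Lemma measurable_preim_bits (f : bits -> bits) (A : set bits) :
  (forall n, exists m, forall z, f z n = z m) ->
  measurable A -> measurable [set z | A (f z)].
Proof.
move=> fP mA; rewrite -[X in measurable X]setTI.
apply: (@measurable_fun_bits _ bits f) => // n.
have [m fm] := fP n; rewrite (_ : [set _ | _] = [set z : bits | z m]).
  exact: measurable_bit.
by apply/seteqP; split=> z /=; rewrite fm.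
Qed.

(** A point of the Cantor space codes a pair with projections [evens] and [odds]; the image of a set
    under [evens] is thus a projection. *)
Definition evens (z : bits) : bits := fun n => z n.*2.
Definition odds (z : bits) : bits := fun n => z n.*2.+1.
Definition interleave (x y : bits) : bits :=
  fun n => if odd n then y n./2 else x n./2.

Lemma interleaveK x y : evens (interleave x y) = x.
Proof. by apply/funext => n; rewrite /evens /interleave odd_double doubleK. Qed.

Lemma odds_interleave x y : odds (interleave x y) = y.
Proof.
by apply/funext => n; rewrite /odds /interleave /= odd_double /= uphalf_double.
Qed.

Lemma interleave_evens_odds z : interleave (evens z) (odds z) = z.
Proof.
apply/funext => n; rewrite /evens /odds /interleave.
case: ifP => on; first by rewrite -[in RHS](odd_double_half n) on.
by rewrite -[in RHS](odd_double_half n) on.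
Qed.

(** * Analytic sets *)

Lemma prefix_bound (f : nat -> nat) n :
  exists N, forall j, (j < n)%N -> (f j < N)%N.
Proof.
exists (\max_(j < n) f j).+1 => j jn; rewrite ltnS.
exact: (leq_bigmax (Ordinal jn)).
Qed.

(* Closedness in the product of the Cantor and the Baire space. *)
Definition closed_rel (K : bits -> (nat -> nat) -> Prop) : Prop :=
  forall z a,
    (forall n, exists z' a', K z' a' /\
       forall i, (i < n)%N -> z' i = z i /\ a' i = a i) ->
    K z a.

Definition analytic (A : set bits) : Prop :=
  exists2 K, closed_rel K & A = [set z | exists a, K z a].

Lemma analytic_clopen n b : analytic [set z | z n = b].
Proof.
exists (fun z _ => z n = b).
  by move=> z a /(_ n.+1)[z' [a' [<- /(_ n (ltnSn n))[-> _]]]].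
by apply/seteqP; split=> z /=; [exists (fun=> 0%N) | move=> []].
Qed.

(** The first entry of the witness names the index [i]; the rest is a witness for [A i]. *)
Lemma analytic_bigcup (A : nat -> set bits) :
  (forall i, analytic (A i)) -> analytic (\bigcup_i A i).
Proof.
move=> /(_ _)/cid2 -/all_sig2[K Kcl AE].
exists (fun z a => K (a 0%N) z (fun j => a j.+1)).
  move=> z a H; apply: Kcl => n.
  have [z' [a' [Kz' e]]] := H n.+1.
  have [_ a0] := e 0%N isT; rewrite a0 in Kz'.
  exists z', (fun j => a' j.+1); split=> // i ilt; split.
    by have [] := e i (ltnW ilt).
  by have [] := e i.+1 ilt.
apply/seteqP; split=> z /=.
  move=> [i _]; rewrite AE => -[a Ka].
  by exists (fun j => if j is j'.+1 then a j' else i).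
by move=> [a Ka]; exists (a 0%N) => //; rewrite AE; exists (fun j => a j.+1).
Qed.

(** One sequence stores a witness for every [A i], with entry [j] at position [pickle (i, j)]. *)
Lemma analytic_bigcap (A : nat -> set bits) :
  (forall i, analytic (A i)) -> analytic (\bigcap_i A i).
Proof.
move=> /(_ _)/cid2 -/all_sig2[K Kcl AE].
exists (fun z a => forall i, K i z (fun j => a (pickle (i, j)))).
  move=> z a H i; apply: Kcl => n.
  have [N ltN] := prefix_bound (fun j => pickle (i, j)) n.
  have [z' [a' [Kz' e]]] := H (maxn n N).
  exists z', (fun j => a' (pickle (i, j))); split=> // j jn; split.
    by have [] := e j (leq_trans jn (leq_maxl _ _)).
  by have [] := e _ (leq_trans (ltN _ jn) (leq_maxr _ _)).
apply/seteqP; split=> z /=.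
  move=> Az; have /choice[a Ka] : forall i, exists a, K i z a.
    by move=> i; have := Az i I; rewrite AE.
  exists (fun n => if unpickle n is Some (i, j) then a i j else 0%N) => i.
  by rewrite (_ : (fun j => _) = a i) //; apply/funext => j; rewrite pickleK.
by move=> [a Ka] i _; rewrite AE; exists (fun j => a (pickle (i, j))).
Qed.

(** The sets that are analytic together with their complements form a sigma-algebra containing the
    bit cylinders. *)
Lemma analytic_measurable (A : set bits) : measurable A -> analytic A.
Proof.
suff H : <<s bit_cylinders >> `<=` [set A | analytic A /\ analytic (~` A)].
  by move=> /H[].
have a0 : analytic set0.
  by exists (fun _ _ => False) => [z a /(_ 0%N)[z' [a' []]]|] //;
    apply/seteqP; split=> // z [].
have aT : analytic setT.
  by exists (fun _ _ => True) => //; apply/seteqP; split=> // z _; exists (fun=> 0%N).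
apply: smallest_sub.
  split=> [|B [aB aCB]|F aF]; first by rewrite /= setC0.
    by rewrite /= setTD setCK.
  split; first by apply: analytic_bigcup => i; have [] := aF i.
  by rewrite setC_bigcup; apply: analytic_bigcap => i; have [] := aF i.
move=> _ [n _ <-]; split; first exact: (analytic_clopen n true).
rewrite (_ : ~` _ = [set z | z n = false]); first exact: analytic_clopen.
by apply/seteqP; split=> z /=; case: (z n).
Qed.

(** * Separation of countably many analytic sets *)

Definition separated (A : nat -> set bits) : Prop :=
  exists2 B : nat -> set bits,
    forall i, measurable (B i) /\ A i `<=` B i & \bigcap_i B i = set0.

Lemma separated_set0 (A : nat -> set bits) i : A i = set0 -> separated A.
Proof.
move=> Ai; exists (fun j => if j == i then set0 else setT).
  by move=> j; case: eqP => [->|_]; rewrite ?Ai; split.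
by apply/seteqP; split=> // x /(_ i I); rewrite eqxx.
Qed.

Lemma separated_setC (A : nat -> set bits) (M : set bits) i j :
  i != j -> measurable M -> A i `<=` M -> A j `<=` ~` M -> separated A.
Proof.
move=> ij mM AiM AjM.
exists (fun k => if k == i then M else if k == j then ~` M else setT).
  move=> k; case: eqP => [->|_]; first by split.
  by case: eqP => [->|_]; split=> //; exact: measurableC.
apply/seteqP; split=> // x Bx; have := Bx i I; have := Bx j I.
by rewrite !eqxx eq_sym (negbTE ij).
Qed.

(** The separator of [A i] is the union over [v] of those of its pieces; the others are
    intersections over [v]. A point common to all would lie in every [B v j] for a single [v]. *)
Lemma separated_split (V : countType) (A : nat -> set bits)
    (A' : V -> nat -> set bits) i :
  A i `<=` \bigcup_v A' v i -> (forall v j, j != i -> A j `<=` A' v j) ->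
  (forall v, separated (A' v)) -> separated A.
Proof.
move=> Ai Aj /(_ _)/cid2 -/all_sig2[B BP B0].
exists (fun j => if j == i then [set x | exists v, B v i x]
                 else [set x | forall v, B v j x]).
  move=> j; case: ifPn => [/eqP ->|ji]; split.
  - by apply: measurable_exists => v; have [] := BP v i.
  - by move=> x /Ai[v _ A'x]; exists v; apply: (BP v i).2.
  - by apply: measurable_forall => v; have [] := BP v j.
  - by move=> x Ax v; apply: (BP v j).2; exact: Aj Ax.
apply/seteqP; split=> // x Bx.
have := Bx i I; rewrite eqxx => -[v Bvx].
rewrite -(B0 v) => j _; have [->//|ji] := eqVneq j i.
by have := Bx j I; rewrite (negbTE ji) => /(_ v).
Qed.

(* Inseparability passes to some piece of a countable decomposition of one set of
   the family. Stage [pickle (i, j)] decomposes the [i]-th set according to the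
   [j]-th coordinates of its points and witnesses; in the limit the inseparable
   pieces shrink to a common point. *)
Lemma novikov_separation (A : nat -> set bits) :
  (forall i, measurable (A i)) -> \bigcap_i (evens @` A i) = set0 ->
  separated (fun i => evens @` A i).
Proof.
move=> mA A0; apply: contrapT => nsep.
have /(_ _)/cid2 -/all_sig2[K Kcl AE] := fun i => analytic_measurable _ (mA i).
(* A stage outside the range of [pickle] refines set 0 by coordinate 0 again, which is harmless. *)
pose unp n : nat * nat := odflt (0, 0)%N (unpickle n).
have unpK p : unp (pickle p) = p by rewrite /unp pickleK.
pose piece (s : seq (nat * bool)) i := [set evens w | w in
  [set w | exists2 a, K i w a & forall m, (m < size s)%N -> (unp m).1 = i ->
     (a (unp m).2, w (unp m).2) = nth (0%N, false) s m]].
have /choice[f fP] : forall s, exists v,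
    ~ separated (piece s) -> ~ separated (piece (rcons s v)).
  move=> s; apply: contrapT => /forallNP nv.
  have /not_implyP[ns _] := nv (0%N, false).
  apply: ns; apply: (@separated_split _ _ (fun v => piece (rcons s v))
    (unp (size s)).1).
  - move=> x [w [a Ka aP] <-].
    exists (a (unp (size s)).2, w (unp (size s)).2) => //.
    exists w => //; exists a => // m; rewrite size_rcons ltnS leq_eqVlt.
    rewrite nth_rcons => /orP[/eqP->|ms mi].
      by rewrite ltnn eqxx.
    by rewrite ms; exact: aP.
  - move=> v j ji x [w [a Ka aP] <-]; exists w => //; exists a => // m.
    rewrite size_rcons ltnS leq_eqVlt nth_rcons => /orP[/eqP-> /esym jE|ms mi].
      by rewrite jE eqxx in ji.
    by rewrite ms; exact: aP.
  - by move=> v; have /not_implyP[_ /contrapT] := nv v.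
pose S n := iter n (fun s => rcons s (f s)) [::].
pose v m := f (S m).
have sizeS n : size (S n) = n by elim: n => //= n IH; rewrite size_rcons IH.
have nthS n m : (m < n)%N -> nth (0%N, false) (S n) m = v m.
  elim: n => //= n IH; rewrite ltnS leq_eqVlt nth_rcons sizeS => /orP[/eqP->|mn].
    by rewrite ltnn eqxx.
  by rewrite mn IH.
have nsepS n : ~ separated (piece (S n)).
  elim: n => [sep|n IH]; last exact: fP.
  apply: nsep; rewrite (_ : (fun i => _) = piece [::]) //.
  apply/funext => i; apply/seteqP; split=> x [w].
    by rewrite AE => -[a Ka] <-; exists w => //; exists a.
  by case=> a Ka _ <-; exists w => //; rewrite AE; exists a.
pose al (i j : nat) := (v (pickle (i, j))).1.
pose b (i : nat) : bits := fun j : nat => (v (pickle (i, j))).2.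
have pieceP n i x : piece (S n) i x -> exists w a, [/\ evens w = x, K i w a &
    forall j, (pickle (i, j) < n)%N -> w j = b i j /\ a j = al i j].
  move=> [w [a Ka aP] <-]; exists w, a; split=> // j jn.
  have := aP (pickle (i, j)); rewrite sizeS unpK => /(_ jn erefl).
  by rewrite nthS // /b /al => <-.
(* An inseparable family has no empty member, so [K i] has points agreeing with the limit on
   arbitrarily long prefixes, and closedness applies. *)
have Kb i : K i (b i) (al i).
  apply: Kcl => n; have [N ltN] := prefix_bound (fun j => pickle (i, j)) n.
  have [x /pieceP[w [a [_ Ka aP]]]] : piece (S N) i !=set0.
    apply/set0P/eqP => p0; exact: (nsepS N (separated_set0 _ _ p0)).
  by exists w, a; split=> // j /ltN/aP.
(* If two limits had projections differing in bit [n], the clopen set fixing that bit would separate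
   the pieces of a late stage. *)
have bE i j : evens (b i) = evens (b j).
  apply/funext => n; apply: contrapT => bij.
  have ij : i != j by apply/eqP => ij; apply: bij; rewrite ij.
  pose N := (maxn (pickle (i, n.*2)) (pickle (j, n.*2))).+1.
  apply: (nsepS N); apply: (@separated_setC _ [set x | x n = evens (b i) n] i j ij).
  - exact: measurable_bit_eq.
  - move=> x /pieceP[w [a [<- _ wP]]] /=; rewrite /evens.
    by have [] := wP n.*2; rewrite // ltnS leq_maxl.
  - move=> x /pieceP[w [a [<- _ wP]]] /=; rewrite /evens => wb; apply: bij.
    rewrite /evens -wb; have [] := wP n.*2 => //.
    by rewrite ltnS leq_maxr.
have : (\bigcap_i (evens @` A i)) (evens (b 0%N)).
  by move=> i _; exists (b i); rewrite ?AE; [exists (al i) | exact: bE].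
by rewrite A0.
Qed.

(** Separate the sequence A, B, B, ...: all separators but the first contain the projection of [B],
    so the first misses it. *)
Lemma separate_evens_images (A B : set bits) : measurable A -> measurable B ->
  (evens @` A) `&` (evens @` B) = set0 ->
  exists2 M : set bits, measurable M & evens @` A `<=` M /\ M `&` (evens @` B) = set0.
Proof.
move=> mA mB AB; have [||C CP C0] :=
  novikov_separation (fun i => if i is 0%N then A else B).
- by case.
- apply/seteqP; split=> // x ABx; rewrite -AB.
  by split; [exact: (ABx 0%N)|exact: (ABx 1%N)].
exists (C 0%N); first exact: (CP 0%N).1.
split; first exact: (CP 0%N).2.
apply/seteqP; split=> // x [C0x Bx]; rewrite -C0 => -[|i] _ //.
exact: (CP i.+1).2.
Qed.

(** * Projections of Borel sets with closed sections *)

Definition prefix_cylinder (s : seq bool) : set bits :=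
  [set w | forall i, (i < size s)%N -> odds w i = nth false s i].

Lemma measurable_prefix_cylinder s : measurable (prefix_cylinder s).
Proof.
apply: measurable_forall => i; apply: measurable_impl; first exact: measurable_prop.
exact: measurable_bit_eq.
Qed.

Lemma prefix_cylinder_rcons s w : prefix_cylinder s w ->
  prefix_cylinder (rcons s (odds w (size s))) w.
Proof.
move=> sw i; rewrite size_rcons ltnS leq_eqVlt nth_rcons => /orP[/eqP ->|si].
  by rewrite ltnn eqxx.
by rewrite si; exact: sw.
Qed.

(* [barred M n s] collects the [x] such that every branch through [s] has, within
   [n] steps, an initial segment [t] with [M t x]. *)
Fixpoint barred (M : seq bool -> set bits) n s : set bits :=
  if n is n'.+1
  then M s `|` (barred M n' (rcons s true) `&` barred M n' (rcons s false))
  else M s.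

(** A point is off the projection exactly when the sets [M s], which miss the projection of the part
    of [F] over the prefix [s], bar all branches. By compactness a finite depth suffices, so the
    complement is a countable union of measurable sets. *)
Lemma measurable_evens_image (F : set bits) : measurable F ->
  (forall w, (forall n, exists w', [/\ F w', evens w' = evens w &
     forall i, (i < n)%N -> odds w' i = odds w i]) -> F w) ->
  measurable (evens @` F).
Proof.
move=> mF Fcl.
(* [A n] projects to the points off [F] that agree up to [n] with a point of [F]
   in the same section; closedness of the sections leaves none for all [n]. *)
pose A n := [set v : bits | ~ F (evens v) /\
  (F (interleave (evens (evens v)) (odds v)) /\
   forall i, (i < n)%N -> odds v i = odds (evens v) i)].
have mA n : measurable (A n).
  apply: measurableI.
    apply: (measurable_preim_bits evens (~` F)); last exact: measurableC.
    by move=> k; exists k.*2.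
  apply: measurableI.
    apply: (measurable_preim_bits
      (fun v => interleave (evens (evens v)) (odds v))) => // k.
    rewrite /interleave.
    by case: (odd k); [exists k./2.*2.+1 | exists k./2.*2.*2].
  apply: measurable_forall => i; apply: measurable_impl.
    exact: measurable_prop.
  rewrite [X in measurable X](_ : _ = \bigcup_(b : bool)
      ([set v : bits | v i.*2.+1 = b] `&` [set v : bits | v i.*2.+1.*2 = b])).
    apply: countable_bigcupT_measurable => // b.
    by apply: measurableI; exact: measurable_bit_eq.
  apply/seteqP; split=> v /=; rewrite /odds /evens.
    by move=> e; exists (v i.*2.+1).
  by move=> [b _ [-> ->]].
have [//||B BP B0] := novikov_separation A.
  apply/seteqP; split=> // w Aw.
  have nFw : ~ F w by have [v [? _] <-] := Aw 0%N I.
  apply: nFw; apply: Fcl => n; have [v [_ [Fv e]] <-] := Aw n I.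
  exists (interleave (evens (evens v)) (odds v)).
  by rewrite interleaveK odds_interleave.
have mB n : measurable (B n) by have [] := BP n.
(* If [w] off [F] and [w'] in [F] share their section and the prefix [s], then [w] is in the
   projection of [A (size s)], hence in [B (size s)]. Removing that set makes the two projections
   disjoint. *)
have /(_ _)/cid2 -/all_sig2[M mM MP] : forall s : seq bool, exists2 M : set bits,
    measurable M &
    evens @` ((~` F `&` prefix_cylinder s) `\` B (size s)) `<=` M /\
    M `&` (evens @` (F `&` prefix_cylinder s)) = set0.
  move=> s; apply: separate_evens_images.
  - apply: measurableD => //; apply: measurableI; first exact: measurableC.
    exact: measurable_prefix_cylinder.
  - by apply: measurableI => //; exact: measurable_prefix_cylinder.
  apply/seteqP; split=> // x [[w [[nFw ws] Bw] <-] [w' [Fw' w's] ww']].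
  apply: Bw; apply: (BP (size s)).2; exists (interleave w (odds w')).
    rewrite /A /= interleaveK odds_interleave -ww' interleave_evens_odds.
    by split=> //; split=> // i si; rewrite w's // ws.
  by rewrite interleaveK.
pose D := barred M.
have mD n s : measurable (D n s).
  elim: n s => [|n IH] s /=; first exact: mM.
  by apply: measurableU; [exact: mM | exact: measurableI].
have leD m n s : (m <= n)%N -> D m s `<=` D n s.
  rewrite /D; elim: n m s => [|n IH] [|m] s //= mn x //.
  by move=> [?|[? ?]]; [left | right; split; exact: IH mn _ _].
rewrite (_ : evens @` F = ~` \bigcup_n D n [::]).
  by apply: measurableC; exact: bigcupT_measurable.
apply/seteqP; split=> x.
  move=> [w Fw <-] [n _].
  have : prefix_cylinder [::] w by [].
  elim: n [::] => [|n IH] s ws /=.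
    move=> Mw; suff : set0 (evens w) by [].
    by rewrite -(MP s).2; split=> //; exists w.
  case=> [Mw|].
    suff : set0 (evens w) by [].
    by rewrite -(MP s).2; split=> //; exists w.
  have := IH _ (prefix_cylinder_rcons _ _ ws).
  by case: (odds w (size s)) => H [].
move=> nDx.
(* König's lemma: barring is monotone in the depth, so a prefix barred at no depth has a one-bit
   extension barred at no depth. *)
have /choice[f fP] : forall s, exists b, (forall n, ~ D n s x) ->
    forall n, ~ D n (rcons s b) x.
  move=> s; apply: contrapT => /forallNP nb.
  have /not_implyP[nD /existsNP[n /contrapT Dn]] := nb true.
  have /not_implyP[_ /existsNP[m /contrapT Dm]] := nb false.
  apply: (nD (maxn n m).+1); right.
  by split; [apply: leD Dn; exact: leq_maxl | apply: leD Dm; exact: leq_maxr].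
pose S n := iter n (fun s => rcons s (f s)) [::].
have sizeS n : size (S n) = n by elim: n => //= n IH; rewrite size_rcons IH.
pose y : bits := fun m => f (S m).
have nthS n m : (m < n)%N -> y m = nth false (S n) m.
  elim: n => //= n IH; rewrite ltnS leq_eqVlt nth_rcons sizeS => /orP[/eqP->|mn].
    by rewrite ltnn eqxx.
  by rewrite mn IH.
have nDS n : forall m, ~ D m (S n) x.
  elim: n => [m Dm|n IH]; last exact: fP.
  by apply: nDx; exists m.
have [Fxy|nFxy] := EM (F (interleave x y)).
  by exists (interleave x y); rewrite ?interleaveK.
(* A point off [F] avoids some [B n]; then [x] lies in [M (S n)], and the branch is barred after
   all. *)
have [n nBn] : exists n, ~ B n (interleave x y).
  apply/existsNP => Bxy; suff : set0 (interleave x y) by [].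
  by rewrite -B0 => n _.
case: (nDS n 0%N); apply: (MP (S n)).1; exists (interleave x y).
  rewrite sizeS; split=> //; split=> // i; rewrite sizeS odds_interleave.
  exact: nthS.
by rewrite interleaveK.
Qed.

(** * Walks in relations with finite sections on the Cantor space *)

Lemma finite_bits_closed (S : set bits) (y : bits) : finite_set S ->
  (forall n, exists2 z, S z & forall i, (i < n)%N -> z i = y i) -> S y.
Proof.
move=> /finite_seqP[s ->] H; apply: contrapT => /negP ys.
suff [n nP] : exists n, forall z, z \in s -> exists2 i, (i < n)%N & z i <> y i.
  by have [z /nP[i ilt zy] /(_ i ilt)] := H n.
elim: s ys {H} => [|z s IH]; first by exists 0%N.
rewrite in_cons negb_or => /andP[yz /IH[n nP]].
have [i zi] : exists i, z i <> y i.
  by apply/existsNP => zy; case/eqP: yz; apply/funext => i; rewrite zy.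
exists (maxn n i.+1) => u; rewrite in_cons => /orP[/eqP->|/nP[j jn uj]].
  by exists i; rewrite // leq_maxr.
by exists j; rewrite // (leq_trans jn) // leq_maxl.
Qed.

(** Induction on the length: the second vertex of the walk becomes an extra coordinate, which can be
    projected away because its sections are finite, hence closed. *)
Lemma measurable_walk_bits (H : set (bits * bits)) :
  measurable [set w | H (evens w, odds w)] ->
  (forall x, finite_set [set y | H (x, y)]) ->
  forall n, measurable [set w | walk H n (evens w) (odds w)].
Proof.
move=> mH finH; elim=> [|n IH] /=.
  rewrite (_ : [set _ | _] = [set w : bits | forall i, exists b : bool,
      ([set w : bits | w i.*2 = b] `&` [set w : bits | w i.*2.+1 = b]) w]).
    apply: measurable_forall => i; apply: measurable_exists => b.
    by apply: measurableI; exact: measurable_bit_eq.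
  apply/seteqP; split=> w /= e.
    move=> i; exists (w i.*2); split=> //=.
    by rewrite -[w i.*2.+1]/(odds w i) -e.
  by apply/funext => i; have [b [<- /= ]] := e i.
(* Here [evens v] codes the pair of end points and [odds v] is the second vertex. *)
pose F := [set v : bits | H (evens (evens v), odds v) /\
                          walk H n (odds v) (odds (evens v))].
have -> : [set w : bits | exists2 z, H (evens w, z) & walk H n z (odds w)] =
          evens @` F.
  apply/seteqP; split=> w /=.
    move=> [z Hwz zw]; exists (interleave w z); last exact: interleaveK.
    by rewrite /F /= interleaveK odds_interleave.
  by move=> [v [Hv vw] <-]; exists (odds v).
apply: measurable_evens_image.
  have mix (g : bits -> bits) (h : bits -> bits) :
      (forall k, exists m, forall z, g z k = z m) ->
      (forall k, exists m, forall z, h z k = z m) ->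
      forall A : set bits, measurable A ->
      measurable [set v | A (interleave (g v) (h v))].
    move=> gP hP A.
    apply: (measurable_preim_bits (fun v => interleave (g v) (h v))) => k.
    rewrite /interleave.
    by case: (odd k); [exact: hP | exact: gP].
  apply: measurableI.
    have := mix (evens \o evens) odds _ _ _ mH.
    under eq_set do rewrite /= interleaveK odds_interleave.
    by apply=> k; [exists k.*2.*2 | exists k.*2.+1].
  have := mix odds (odds \o evens) _ _ _ IH.
  under eq_set do rewrite /= interleaveK odds_interleave.
  by apply=> k; [exists k.*2.+1 | exists k.*2.+1.*2].
move=> w Fw.
have [] : [set z | H (evens (evens w), z) /\ walk H n z (odds (evens w))] (odds w).
  apply: finite_bits_closed.
    by apply: sub_finite_set (finH (evens (evens w))) => z [].
  by move=> k; have [w' [[? ?] e ?]] := Fw k; exists (odds w') => //=; rewrite -e.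
by [].
Qed.

(** * Coding standard Borel spaces in the Cantor space *)

Section PolishCoding.
Context (R : realType) (Y : metricType R).

Lemma metric_ball_open (x : Y) (e : R) : open (ball x e).
Proof.
rewrite openE => y; rewrite ballEmdist /= => xy.
apply/nbhs_ballP; exists (e - mdist x y); rewrite /= ?subr_gt0 // => z.
rewrite !ballEmdist /= => yz; rewrite (le_lt_trans (metric_triangle x y z)) //.
by rewrite -ltrBrDl.
Qed.

Lemma separable_centers (y0 : Y) :
  (exists2 D : set Y, countable D & dense D) ->
  exists (c : nat -> Y) (r : nat -> R),
    forall x e, 0 < e -> exists n, mdist x (c n) < r n /\ r n < e.
Proof.
move=> [D /countable_injP[f finj] denseD].
have /choice[g gP] : forall k, exists y, forall z, D z -> f z = k -> y = z.
  move=> k; have [[z [Dz fz]]|nz] := EM (exists z, D z /\ f z = k).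
    by exists z => w Dw fw; apply: finj; rewrite ?inE // fz.
  by exists y0 => z Dz fz; case: nz; exists z.
pose p n : nat * nat := odflt (0, 0)%N (unpickle n).
exists (fun n => g (p n).1), (fun n => (p n).2.+1%:R^-1) => x e e0.
have [k] := ltr_add_invr e0; rewrite add0r => ke.
have k0 : 0 < k.+1%:R^-1 :> R by rewrite invr_gt0.
have [|z [xz Dz]] := denseD (ball x k.+1%:R^-1) _ (metric_ball_open _ _).
  by exists x; exact: ballxx.
exists (pickle (f z, k)); rewrite /p pickleK /=; split=> //.
by rewrite (gP _ z) //; move: xz; rewrite ballEmdist.
Qed.

Lemma complete_limit (u : nat -> Y) (r : nat -> R) :
  (forall F : set_system Y, ProperFilter F -> cauchy F -> exists y : Y, F --> y) ->
  (forall k, r k < k.+1%:R^-1) ->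
  (forall k l, mdist (u k) (u l) < r k + r l) ->
  exists y, forall e, 0 < e -> exists k, mdist y (u k) < e /\ r k < e.
Proof.
move=> compl r0 ur.
have rlt e : 0 < e -> \forall k \near \oo, r k < e.
  move=> e0; near=> k; apply: lt_trans (r0 k) _.
  by near: k; exact: (near_infty_natSinv_lt (PosNum e0)).
have [|y uy] := compl (u @ \oo) _.
  apply: cauchy_exP => e e0.
  have e20 : 0 < e / 2 by rewrite divr_gt0.
  have [N _ NP] := rlt _ e20.
  exists (u N); exists N => // n Nn; rewrite /= ballEmdist /=.
  have := ur N n; have := NP N (leqnn N); have := NP n Nn; rewrite /=; lra.
exists y => e e0.
have /(_ _ _ e0) uye := (cvg_ballP u y).1 uy.
have [k [/= yk rk]] := filter_ex (filterI uye (rlt _ e0)).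
by exists k; rewrite ballEmdist in yk.
Unshelve. all: by end_near. Qed.

End PolishCoding.

Section Coding.
Context (R : realType) (Y : metricType R) (c : nat -> Y) (r : nat -> R).

Definition code (x : Y) : bits := fun n => mdist x (c n) < r n.

(* The first two conditions make the centers of the listed balls converge, to a
   point [x] say; the third makes the list contain exactly the balls around [x]. *)
Definition codes : set bits := [set s |
  [/\ forall k, exists n, s n /\ r n < k.+1%:R^-1,
      forall n m, s n -> s m -> mdist (c n) (c m) < r n + r m &
      forall m, s m <-> exists n, s n /\ mdist (c n) (c m) + r n < r m]].

Lemma measurable_codes : measurable codes.
Proof.
rewrite (_ : codes =
  [set s : bits | forall k, exists n,
     ([set s : bits | s n] `&` [set _ | r n < k.+1%:R^-1]) s] `&`
  [set s : bits | forall n m, s n -> s m -> mdist (c n) (c m) < r n + r m] `&`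
  [set s : bits | forall m, (s m -> exists n, ([set s : bits | s n] `&`
     [set _ | mdist (c n) (c m) + r n < r m]) s) /\
     ((exists n, ([set s : bits | s n] `&`
     [set _ | mdist (c n) (c m) + r n < r m]) s) -> s m)]); last first.
  apply/seteqP; split=> s; first by move=> [? ? H]; do !split=> //; apply H.
  by move=> [[? ?] H]; split=> // m; split; apply H.
have mb n := measurable_bit n.
have mE (P : nat -> Prop) :
    measurable [set s : bits | exists n, ([set s : bits | s n] `&` [set _ | P n]) s].
  apply: measurable_exists => n; apply: measurableI => //; exact: measurable_prop.
apply: measurableI; first apply: measurableI.
- by apply: measurable_forall => k; exact: mE.
- apply: measurable_forall => n; apply: measurable_forall => m.
  apply: (@measurable_impl _ _ _ _ (mb n)); apply: (@measurable_impl _ _ _ _ (mb m)).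
  exact: measurable_prop.
apply: measurable_forall => m.
have mEm := mE (fun n => mdist (c n) (c m) + r n < r m).
by apply: measurableI; [exact: (@measurable_impl _ _ _ _ (mb m) mEm) |
                        exact: (@measurable_impl _ _ _ _ mEm (mb m))].
Qed.

Hypothesis cr : forall x e, 0 < e -> exists n, mdist x (c n) < r n /\ r n < e.

(** Points with the same code share, for every [e], a listed ball of radius below [e / 2]. *)
Lemma code_inj : injective code.
Proof.
move=> x y xy; apply/mdist_positivity/eqP; rewrite eq_le mdist_ge0 andbT.
apply/ler_addgt0Pl => e e0; rewrite addr0.
have [n [xn rn]] := cr x _ (divr_gt0 e0 (ltr0n R 2)).
have yn : mdist y (c n) < r n by rewrite -[_ < _]/(code y n) -xy.
have := metric_triangle x (c n) y; rewrite (metric_sym (c n) y); lra.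
Qed.

Lemma code_codes x : codes (code x).
Proof.
rewrite /code; split=> [k|n m xn xm|m].
- by apply: cr; rewrite invr_gt0.
- have := metric_triangle (c n) x (c m); rewrite (metric_sym (c n) x); lra.
split=> [xm|[n [xn nm]]].
  have e0 : 0 < (r m - mdist x (c m)) / 2 by lra.
  have [n [xn rn]] := cr x _ e0; exists n; split=> //.
  have := metric_triangle (c n) x (c m); rewrite (metric_sym (c n) x); lra.
have := metric_triangle x (c n) (c m); lra.
Qed.

Lemma codes_code :
  (forall F : set_system Y, ProperFilter F -> cauchy F -> exists y : Y, F --> y) ->
  forall s, codes s -> exists x, code x = s.
Proof.
move=> compl s [/choice[n nP] s2 s3].
have [||x xP] := @complete_limit _ _ (c \o n) (r \o n) compl.
- by move=> k; have [] := nP k.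
- by move=> k l; apply: s2; [have [] := nP k | have [] := nP l].
(* The limit only gives a weak inequality; the third condition on codes, which provides a smaller
   listed ball, makes it strict at the end. *)
have le m : s m -> mdist x (c m) <= r m.
  move=> sm; apply/ler_addgt0Pl => e e0.
  have [k [/= xk rk]] := xP _ (divr_gt0 e0 (ltr0n R 2)).
  have := s2 _ _ (nP k).1 sm; have := metric_triangle x (c (n k)) (c m); lra.
exists x; apply/funext => m; apply/idP/idP; rewrite /code => xm.
  apply/s3; have e0 : 0 < (r m - mdist x (c m)) / 2 by lra.
  have [k [/= xk rk]] := xP _ e0; exists (n k); split; first exact: (nP k).1.
  have := metric_triangle (c (n k)) x (c m); rewrite (metric_sym _ x); lra.
have [k [sk km]] := (s3 m).1 xm.
have := le k sk; have := metric_triangle x (c k) (c m); lra.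
Qed.

End Coding.

Lemma standard_borel_code (R : realType) d (X : measurableType d) :
  standard_borel R X ->
  exists e : X -> bits,
    [/\ injective e, measurable_fun setT e, measurable (range e) &
        forall A, measurable A -> exists2 B, measurable B & A = e @^-1` B].
Proof.
move=> [Y [f [[compl sep] fbij fmeas]]].
(* The list of balls needs a point of the space, so the empty space is treated apart. *)
have [[x0 _]|X0] := EM (exists x : X, True); last first.
  exists (fun=> point); split.
  - by move=> x; case: X0; exists x.
  - move=> _ A mA; rewrite (_ : _ `&` _ = set0) //.
    by apply/seteqP; split=> // x; case: X0; exists x.
  - rewrite (_ : range _ = set0) //.
    by apply/seteqP; split=> // y [x]; case: X0; exists x.
  - move=> A _; exists set0 => //.
    by apply/seteqP; split=> x; case: X0; exists x.
have [c [r cr]] := separable_centers _ _ (f x0) sep.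
have finj := bij_inj fbij.
exists (code _ _ c r \o f); split.
- by move=> x y /code_inj/finj; apply.
- apply: measurable_fun_bits => n; apply/fmeas; exists (ball (c n) (r n)).
    by apply: sub_sigma_algebra; exact: metric_ball_open.
  by apply/seteqP; split=> x; rewrite ballEmdist /= metric_sym.
- rewrite (_ : range _ = codes _ _ c r); first exact: measurable_codes.
  apply/seteqP; split=> [_ [x _ <-]|s /codes_code[//|y <-]].
    exact: code_codes.
  by have [g _ fg] := fbij; exists (g y) => //=; rewrite fg.
move=> A /fmeas[B sB ->].
suff /(_ _ sB)[C mC <-] : <<s [set U : set Y | open U] >> `<=`
    preimage_set_system setT (code _ _ c r) (@measurable _ bits).
  by exists C; rewrite // setTI.
apply: smallest_sub.
  by apply: sigma_algebra_preimage; exact: sigma_algebra_measurable.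
(* An open set is the union of the listed balls inside it, and membership in a listed ball is one
   bit of the code. *)
move=> U oU; exists [set s : bits | exists n,
    ([set s : bits | s n] `&` [set _ | ball (c n) (r n) `<=` U]) s].
  apply: measurable_exists => n.
  by apply: measurableI; [exact: measurable_bit | exact: measurable_prop].
rewrite setTI; apply/seteqP; split=> x /=.
  by move=> [n [xn]]; apply; rewrite ballEmdist /= metric_sym.
move=> Ux; have /nbhs_ballP[e /= e0 eU] := open_nbhs_nbhs (conj oU Ux).
have [n [xn rn]] := cr x _ (divr_gt0 e0 (ltr0n R 2)).
exists n; split=> // y; rewrite ballEmdist /= => ny; apply: eU.
rewrite ballEmdist /=; have := metric_triangle x (c n) y; lra.
Qed.

(** * Measurability of the connectedness relation *)

Section WalkTransfer.
Context (X Y : Type) (e : X -> Y) (H : set (X * X)).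

Definition image_graph : set (Y * Y) :=
  [set p | exists x y, [/\ p.1 = e x, p.2 = e y & H (x, y)]].

Lemma walk_image_graph n x y : injective e ->
  walk H n x y <-> walk image_graph n (e x) (e y).
Proof.
move=> einj; elim: n x => [|n IH] x /=; first by split=> [->|/einj].
split=> [[z xz /IH zy]|[_ [x' [z [/= /einj <- -> xz]]] /IH zy]].
  by exists (e z) => //; exists x, z.
by exists z.
Qed.

End WalkTransfer.

(** The coding carries [H] to a measurable relation on the Cantor space with finite sections; [E_ H]
    is the union over lengths of the pulled-back walk relations. *)
Lemma measurable_connected (R : realType) d (X : measurableType d) (H : set (X * X)) :
  standard_borel R X -> measurable H -> (forall x, finite_set [set y | H (x, y)]) ->
  measurable (E_ H).
Proof.
move=> /standard_borel_code[e [einj me mrange eP]] mH finH.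
pose pe (p : X * X) : bits := interleave (e p.1) (e p.2).
have mpe : measurable_fun setT pe.
  have mbit (g : X * X -> X) k : measurable_fun setT g ->
      measurable [set p | e (g p) k].
    move=> mg; have := measurableT_comp me mg measurableT (measurable_bit k).
    by rewrite setTI.
  apply: measurable_fun_bits => n; rewrite /pe /interleave.
  by case: (odd n); apply: mbit; [exact: measurable_snd | exact: measurable_fst].
have peP A : measurable A -> exists2 B, measurable B & A = pe @^-1` B.
  rewrite measurable_prod_measurableType => sA.
  suff /(_ _ sA)[B mB <-] : <<s [set A `*` B | A in measurable & B in measurable] >>
      `<=` preimage_set_system setT pe (@measurable _ bits).
    by exists B; rewrite // setTI.
  apply: smallest_sub.
    by apply: sigma_algebra_preimage; exact: sigma_algebra_measurable.
  move=> _ [A1 /eP[B1 mB1 ->]] [A2 /eP[B2 mB2 ->] <-].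
  exists ([set w | B1 (evens w)] `&` [set w | B2 (odds w)]).
    by apply: measurableI; apply: (@measurable_preim_bits) => // k;
      [exists k.*2 | exists k.*2.+1].
  by rewrite setTI; apply/seteqP; split=> p /=;
    rewrite /pe interleaveK odds_interleave.
have [B mB HB] := peP _ mH.
(* [B] is controlled only on pairs of codes, so it is cut down to the measurable range of [e] in
   both coordinates. *)
have mH' : measurable [set w | image_graph _ _ e H (evens w, odds w)].
  rewrite (_ : [set _ | _] = B `&` ([set w | range e (evens w)] `&`
                                   [set w | range e (odds w)])).
    by apply: measurableI => //; apply: measurableI;
      apply: (@measurable_preim_bits) => // k; [exists k.*2 | exists k.*2.+1].
  apply/seteqP; split=> w /=.
    move=> [x [y [/= xw yw]]]; rewrite HB /= /pe /= -xw -yw interleave_evens_odds.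
    by move=> Bw; split=> //; split; [exists x | exists y].
  move=> [Bw [[x _ xw] [y _ yw]]]; exists x, y; split=> //.
  by rewrite HB /= /pe /= xw yw interleave_evens_odds.
rewrite (_ : E_ H = [set p | exists n,
   (pe @^-1` [set w | walk (image_graph _ _ e H) n (evens w) (odds w)]) p]).
  apply: measurable_exists => n; rewrite -[X in measurable X]setTI; apply: mpe => //.
  apply: measurable_walk_bits => // u.
  have [[x xu]|nu] := EM (exists x, e x = u); last first.
    rewrite (_ : [set _ | _] = set0) //; apply/seteqP; split=> // v [x [y [/= ux]]].
    by case: nu; exists x.
  apply: sub_finite_set (finite_image e (finH x)) => v [x' [y [/= ux -> H']]].
  by exists y => //=; rewrite (einj x x') // xu.
apply/seteqP; split=> p [n] /=; rewrite /pe interleaveK odds_interleave => w;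
  by exists n; apply/(walk_image_graph _ _ e H n _ _ einj).
Qed.

(** * Walks, connectedness and distance in graphs *)

Section Walks.
Context {X : Type}.
Implicit Types (G : set (X * X)) (A : set X).

Lemma walk_cat G n m x y z : walk G n x y -> walk G m y z -> walk G (n + m) x z.
Proof.
by elim: n x => [|n IH] x /= => [->|[u xu uy] yz] //; exists u => //; exact: IH.
Qed.

Lemma walk1 G x y : G (x, y) -> walk G 1 x y.
Proof. by move=> xy; exists y. Qed.

Lemma connected_trans G x y z :
  connected_in G x y -> connected_in G y z -> connected_in G x z.
Proof. by move=> [n xy] [m yz]; exists (n + m)%N; exact: walk_cat xy yz. Qed.

Lemma connected_sym G x y : (forall x y, G (x, y) -> G (y, x)) ->
  connected_in G x y -> connected_in G y x.
Proof.
move=> symG [n]; elim: n x => [|n IH] x /= => [->|[z xz /IH zy]]; first by exists 0%N.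
by apply: connected_trans zy _; exists 1%N; apply: walk1; exact: symG.
Qed.

Lemma connected_sub G G' x y : G `<=` G' -> connected_in G x y -> connected_in G' x y.
Proof.
move=> GG' [n xy]; exists n; elim: n x xy => //= n IH x [z /GG' xz /IH zy].
by exists z.
Qed.

Lemma connected_restrict G A x y :
  A x -> connected_in (restrict_graph G A) x y -> A y.
Proof.
by move=> + [n]; elim: n x => [|n IH] x /= => [? <-|_ [z [_ [_ Az]] /IH]] //; exact.
Qed.

Lemma restrict_graph_sub G A B : A `<=` B ->
  restrict_graph G A `<=` restrict_graph G B.
Proof. by move=> AB p [Gp [Ap Bp]]; split=> //; split; exact: AB. Qed.

Lemma restrict_graph_sym G A : (forall x y, G (x, y) -> G (y, x)) ->
  forall x y, restrict_graph G A (x, y) -> restrict_graph G A (y, x).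
Proof. by move=> symG x y [/symG ? []]. Qed.

Lemma rho_set_edge (R : realType) G A B x y : A `&` B = set0 ->
  A x -> B y -> G (x, y) -> rho_set R G A B = 1%E.
Proof.
move=> AB Ax By Gxy; apply/eqP; rewrite eq_le; apply/andP; split.
  apply: ge_ereal_inf; exists (rho R G x y); first by exists (x, y).
  by apply: ge_ereal_inf; exists 1%E => //; exists 1%N => //; exact: walk1.
apply: le_ereal_inf_tmp => _ [[u v] [/= Au Bv] <-].
apply: le_ereal_inf_tmp => _ [[|n] /= uv <-].
  by exfalso; suff : set0 u by []; rewrite -AB; split=> //; rewrite uv.
by rewrite lee_fin ler1n.
Qed.

(** An infimum below 2 yields a walk of length at most 1, and length 0 would not leave [A]. *)
Lemma boundary_edge (R : realType) G A x : boundary R G A x ->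
  exists2 y, ~ A y & G (x, y).
Proof.
move=> [Ax rho1]; have : (rho_set R G [set x] (~` A) < 2%:E)%E.
  by rewrite rho1 lte_fin ltr1n.
move=> /ereal_inf_lt[_ [[u v] [/= -> nAv] <-]] /ereal_inf_lt[_ [n /= xv <-]].
rewrite lte_fin ltr_nat; case: n xv => [|[|n]] //=.
  by move=> xv; rewrite -xv in nAv.
by move=> [z xz zv] _; exists z; rewrite // zv.
Qed.

End Walks.

(** * The toast of connected components *)

Section ToastFromDecomposition.
Context (R : realType) (disp : measure_display) (X : measurableType disp).
Context (G : set (X * X)) (P : nat) (Q : R) (Xs : nat -> set X).
Hypothesis standardX : standard_borel R X.
Hypothesis borelG : borel_graph G.
Hypothesis wodX : weakly_orthogonal_decomposition G Xs Q.
Hypothesis boundP : geometry_bounded_by R G Xs P.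

(** The shift reconciles toasts indexed from 0 with decompositions indexed from 1. *)
Let D n : set X := ~` tail Xs n.+1.
(** The product discards the walks of length 0 at points outside [D n]. *)
Let T n : set (X * X) := (D n `*` D n) `&` E_ (restrict_graph G (D n)).

Let symG : forall x y, G (x, y) -> G (y, x).
Proof. by have [[]] := borelG. Qed.

Let leD n m : (n <= m)%N -> D n `<=` D m.
Proof.
move=> nm; apply: subsetC => x [k /= mk Xk]; exists k => //=.
exact: leq_trans mk.
Qed.

Let measurableD n : measurable (D n).
Proof.
apply: measurableC; apply: bigcup_measurable => k /= nk.
by apply: (wod_borel wodX); exact: leq_trans nk.
Qed.

Let class_component n x : D n x ->
  [set y | T n (x, y)] = [set y | connected_in (restrict_graph G (D n)) x y].
Proof.
move=> Dx; apply/seteqP; split=> y /= => [[]//|xy].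
by split=> //; split=> //; exact: connected_restrict xy.
Qed.

Let component_finite n x : D n x ->
  finite_set [set y | connected_in (restrict_graph G (D n)) x y].
Proof. by move=> Dx; apply: (wod_finite wodX (k := n.+1)) => //; exists x. Qed.

(** Each section of the restricted graph is empty or contained in a finite component. *)
Let measurableT_ n : measurable (T n).
Proof.
apply: measurableI; first exact: measurableX.
apply: (measurable_connected R) => //.
  by apply: measurableI; [have [] := borelG | exact: measurableX].
move=> x; have [Dx|nDx] := EM (D n x).
  by apply: sub_finite_set (component_finite n x Dx) => y xy; exists 1%N; exact: walk1.
by apply: sub_finite_set (finite_set0 X) => y [_ []].
Qed.

Let T_equivalence n : equivalence_on (D n) (T n).
Proof.
split.
- by move=> p [].
- by move=> x Dx; split=> //; exists 0%N.
- move=> x y [[Dx Dy] xy]; split=> //.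
  by apply: connected_sym xy; exact: restrict_graph_sym.
- move=> x y z [[Dx Dy] xy] [[_ Dz] yz]; split=> //; exact: connected_trans xy yz.
Qed.

(** Take [m] beyond the finitely many indices whose set is at distance 1 from the class: a neighbour
    in a later set would put that set at distance 1 as well. *)
Let neighbours_in n x : D n x -> exists2 m, (n < m)%N &
  forall y z, T n (x, y) -> G (y, z) -> D m z.
Proof.
move=> Dx; set C := [set y | connected_in (restrict_graph G (D n)) x y].
have compC : component G (D n) C by exists x.
have fin : finite_set [set m | (n.+1 <= m)%N /\ rho_set R G C (Xs m) = 1%E].
  exact: card_le_finite (boundP n.+1 C isT compC) (finite_II P).
have [N NP] : exists N, forall m,
    (n.+1 <= m)%N -> rho_set R G C (Xs m) = 1%E -> (m <= N)%N.
  have /finite_seqP[s sE] := fin; exists (\max_(i <- s) i)%N => m nm rm.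
  have : m \in s by have : [set` s] m by rewrite -sE.
  by move=> ms; rewrite (big_rem m) //= leq_maxl.
exists (maxn n.+1 N); first exact: leq_maxl.
move=> y z [[_ Dy] xy] yz [m /= Nm Xm].
have nm : (n.+1 <= m)%N.
  by apply: leq_trans (ltnW Nm); exact: leq_maxl.
have : (m <= N)%N.
  apply: NP => //; apply: (rho_set_edge _ _ _ _ y z) => //.
  apply/seteqP; split=> // u [xu Xu].
  by apply: (connected_restrict _ _ _ _ Dx xu); exists m.
by rewrite leqNgt (leq_ltn_trans _ Nm) // leq_maxr.
Qed.

Lemma borel_toast_components : borel_toast R G D T.
Proof.
split=> //; split.
- by [].
- move=> n p [_]; apply: connected_sub; exact: subIsetl.
- by move=> n _ [x Dx ->]; rewrite class_component //; exact: component_finite.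
- apply/seteqP; split=> // x _; apply: contrapT => nDx.
  suff : set0 x by []; rewrite -(wod_vanish wodX) => -[//|k] _.
  by apply: contrapT => Dx; apply: nDx; exists k.
(* The common point [z] joins [y] to [x], and hence to [u], inside [D m]. *)
- move=> n m _ _ nm [x Dx ->] [y Dy ->] [z [[_ xz] [_ yz]]] u [[_ Du] xu].
  have sub p q : connected_in (restrict_graph G (D n)) p q ->
      connected_in (restrict_graph G (D m)) p q.
    by apply: connected_sub; apply: restrict_graph_sub; apply: leD; exact: ltnW.
  split; first by split=> //; exact: leD (ltnW nm) _ Du.
  apply: connected_trans yz _; apply: sub.
  by apply: connected_trans xu; apply: connected_sym xz; exact: restrict_graph_sym.
move=> n _ [x Dx ->]; have [m nm mP] := neighbours_in n x Dx.
have nDm := leD _ _ (ltnW nm).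
have subT y : T n (x, y) -> T m (x, y).
  move=> [[_ Dy] xy]; split; first by split; exact: nDm.
  by apply: connected_sub xy; exact: restrict_graph_sub.
exists m, [set y | T m (x, y)]; split=> //; first by exists x => //; exact: nDm.
move=> y xy; split; first exact: subT.
(* A boundary point has a neighbour [z] outside the larger class, but [z] is in [D m], and the edge
   to it puts it in that class. *)
move=> bdy; have [z nz yz] := boundary_edge R _ _ _ bdy; apply: nz.
have Dz := mP _ _ xy yz; have [[Dmx Dmy] xmy] := subT _ xy.
split=> //; apply: connected_trans xmy _; exists 1%N; exact: walk1.
Qed.

End ToastFromDecomposition.

Theorem theorem4p12 (R : realType) (disp : measure_display)
    (X : measurableType disp) (G : set (X * X)) (d P : nat) (Q : R)
    (Xs : nat -> set X) :
  standard_borel R X ->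
  borel_graph G ->
  (2 <= d)%N ->
  weakly_orthogonal_decomposition G Xs Q ->
  polygonal_bound R G Xs P ->
  (d * P)%:R <= Q ->
  exists (D : nat -> set X) (T : nat -> set (X * X)), borel_toast R G D T.
Proof.
move=> stdX borG _ wod [boundP _] _.
by eexists; eexists;
exact: (borel_toast_components R disp X G P Q Xs stdX borG wod boundP).
Qed.
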